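(* Let $p\ge 3$ be a prime and let $i,j$ be positive integers. Then $(i,j,1,1)\in\mathcal{A}_{\mathbb{Z}_p}$ if and only if at least one of the following holds: (I) $\nu_2(j-i)>\nu_2(p-1)\ge\nu_2(i+j)$; (II) $\nu_2(j-i)=\nu_2(p-1)\ne\nu_2(i+j)$; (III) $\nu_2(j-i)<\nu_2(p-1)$ and $\gcd(j-i,p-1)$ is not an odd multiple of $\gcd(j+i,p-1)$; (IV) $\nu_2(j-i)<\nu_2(p-1)$, $p\mid i+j$ and $p\nmid i$; (V) $\nu_2(j-ip)<\nu_2(p+1)+\min(\nu_2(j-i),\nu_2(p-1))$ and $j-i$ is not an odd multiple of $\gcd\left(j-ip,(p+1)(j-i),p^2-1\right)$.
   Context: All rings are associative and unital and all homomorphisms are unital. $\mathbb{Z}_p$ is the field with $p$ elements. $\nu_2$ is the $2$-adic valuation on $\mathbb{Z}$: $\nu_2(n)$ is the largest $\nu\ge 0$ with $2^\nu\mid n$ for $n\neq0$, and $\nu_2(0)=\infty$. For a commutative ring $A$ and positive integers $i,j$, $R(A;i,j,1,1)$ is the quotient of the free (noncommutative) $A$-algebra $A\langle x,y\rangle$ by the two-sided ideal generated by $x^iy+yx^j-1$ and $y^2$. For a field $k$, $(i,j,1,1)\in\mathcal{A}_k$ means that there is a non-trivial homomorphism $R(k;i,j,1,1)\to M_2(k)$; equivalently, there exist $2\times2$ matrices $x,y\in M_2(k)$ with $x^iy+yx^j=1$ and $y^2=0$. An odd multiple of an integer $m$ is an integer of the form $cm$ with $c$ an odd integer. *)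

(* Defs.v *)
From HB Require Import structures.
From mathcomp Require Import all_boot all_order all_algebra.
From mathcomp Require Import boolp constructive_ereal.
(* The notations of monalg and constructive_ereal clash. *)
From mathcomp Require Import -(notations) monalg.

Set Implicit Arguments.
Unset Strict Implicit.
Unset Printing Implicit Defensive.

Import Order.TTheory GRing.Theory Num.Theory.
Local Open Scope ring_scope.
Local Open Scope quotient_scope.

Section TwoSidedIdeals.
Variable R : nzRingType.

Definition two_sided_ideal (I : R -> Prop) : Prop :=
  [/\ I 0, forall u v, I u -> I v -> I (u - v)
    & forall a b u, I u -> I (a * u * b)].

Definition gen_ideal (G : seq R) : R -> bool := fun u =>
  `[< forall I : R -> Prop,
        two_sided_ideal I -> (forall g, g \in G -> I g) -> I u >].

Lemma gen_ideal_closed (G : seq R) : zmod_closed (gen_ideal G).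
Proof.
split=> [|u v /asboolP Iu /asboolP Iv]; apply/asboolP => I hI hG.
  by case: hI.
by case: (hI) => _ hB _; apply: hB; [apply: Iu | apply: Iv].
Qed.

HB.instance Definition _ (G : seq R) :=
  GRing.isZmodClosed.Build R (gen_ideal G) (gen_ideal_closed G).

Lemma gen_idealM (G : seq R) a b u :
  u \in gen_ideal G -> a * u * b \in gen_ideal G.
Proof.
move=> /asboolP Iu; apply/asboolP => I hI hG.
by case: (hI) => _ _ hM; apply: hM; apply: Iu.
Qed.

Lemma mem_gen_ideal (G : seq R) g : g \in G -> g \in gen_ideal G.
Proof. by move=> Gg; apply/asboolP => I _ hG; apply: hG. Qed.

End TwoSidedIdeals.

(* ring_quotient only provides ring structures for quotients of commutative
   rings by proper ideals.  The quotient below may be the zero ring, hence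
   it is a pzRingType. *)
Definition quot_ring (R : nzRingType) (G : seq R) : Type :=
  Quotient.quot (GRing.ZmodClosed.clone R (gen_ideal G) _).

Section QuotientRing.
Variables (R : nzRingType) (G : seq R).
Local Notation Q := (quot_ring G).

HB.instance Definition _ := GRing.Zmodule.on Q.
HB.instance Definition _ := ZmodQuotient.on Q.

Definition quot_one : Q := lift_cst Q 1.
Definition quot_mul := lift_op2 Q *%R.

Canonical pi_quot_one_morph := PiConst quot_one.

Lemma quot_eqE x y : (x == y %[mod Q]) = (x - y \in gen_ideal G).
Proof. by rewrite [RHS]Quotient.idealrBE. Qed.

Lemma pi_quot_mul : {morph \pi_Q : x y / x * y >-> quot_mul x y}.
Proof.
move=> x y; unlock quot_mul; apply/eqP; rewrite quot_eqE.
set x' := repr _; set y' := repr _.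
have hx : x - x' \in gen_ideal G by rewrite -quot_eqE reprK.
have hy : y - y' \in gen_ideal G by rewrite -quot_eqE reprK.
have -> : x * y - x' * y' = 1 * (x - x') * y + x' * (y - y') * 1.
  by rewrite mul1r mulr1 mulrBl mulrBr addrA subrK.
by apply: rpredD; apply: gen_idealM.
Qed.
Canonical pi_quot_mul_morph := PiMorph2 pi_quot_mul.

Lemma quot_mulA : associative quot_mul.
Proof. by move=> x y z; rewrite -[x]reprK -[y]reprK -[z]reprK !piE mulrA. Qed.

Lemma quot_mul1r : left_id quot_one quot_mul.
Proof. by move=> x; rewrite -[x]reprK !piE mul1r. Qed.

Lemma quot_mulr1 : right_id quot_one quot_mul.
Proof. by move=> x; rewrite -[x]reprK !piE mulr1. Qed.

Lemma quot_mulDl : left_distributive quot_mul +%R.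
Proof.
by move=> x y z; rewrite -[x]reprK -[y]reprK -[z]reprK !piE mulrDl.
Qed.

Lemma quot_mulDr : right_distributive quot_mul +%R.
Proof.
by move=> x y z; rewrite -[x]reprK -[y]reprK -[z]reprK !piE mulrDr.
Qed.

HB.instance Definition _ := GRing.Zmodule_isPzRing.Build Q
  quot_mulA quot_mul1r quot_mulr1 quot_mulDl quot_mulDr.

End QuotientRing.

(* The algebra of the free monoid on two letters, true for x, false for y. *)
Definition free_alg2 (A : comNzRingType) : Type := malg (fmonom bool) A.
HB.instance Definition _ (A : comNzRingType) := GRing.Lalgebra.on (free_alg2 A).

Definition freeX (A : comNzRingType) : free_alg2 A := mkmalgU (fmu true) 1.
Definition freeY (A : comNzRingType) : free_alg2 A := mkmalgU (fmu false) 1.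

(* R(A; i, j, 1, 1) *)
Definition R11 (A : comNzRingType) (i j : nat) : Type :=
  let x := freeX A in let y := freeY A in
  quot_ring [:: x ^+ i * y + y * x ^+ j - 1; y ^+ 2].
HB.instance Definition _ (A : comNzRingType) (i j : nat) :=
  GRing.PzRing.on (R11 A i j).

(* (i, j, 1, 1) \in A_k *)
Definition in_A11 (k : fieldType) (i j : nat) : Prop :=
  exists f : {rmorphism R11 k i j -> 'M[k]_2}, exists r, f r != 0.

(* logn 2 0 = 0, whereas nu_2(0) is infinite. *)
Definition nu2 (n : int) : \bar int :=
  if n == 0 then +oo%E else (logn 2 `|n|%N)%:Z%:E.
Arguments nu2 n%_R.

Definition odd_multiple (a m : int) : Prop :=
  exists2 c : int, ~~ (2 %| c)%Z & a = c * m.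

(* Main.v *)
Require Import Defs.
From HB Require Import structures.
From mathcomp Require Import all_boot all_order all_algebra.
From mathcomp Require Import cyclic cyclotomic falgebra fieldext separable galois.
From mathcomp Require Import finfield.
From mathcomp Require Import boolp constructive_ereal.
(* The notations of monalg and constructive_ereal clash. *)
From mathcomp Require Import -(notations) monalg.
From mathcomp Require Import ring zify.

Import Order.TTheory GRing.Theory Num.Theory.
Local Open Scope ring_scope.

(** Why the theorem is true. By Cayley-Hamilton, the powers of a matrix [x] of size
    2 are [x^n = U_n x - D U_(n-1)], where [U] is the Lucas sequence attached to the
    trace [T] and the determinant [D] of [x]. The relations [x^i y + y x^j = 1] and
    [y^2 = 0] therefore become conditions on [T] and [D] alone, namely
    [U_i = U_j], [U_i != 0] and [U_(i+1) = D U_(j-1)] ([mx2_relations_lucas]).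

    Let [a], [b] be the eigenvalues of [x]. For [a != b] the conditions say that
    [a^i = - b^j], [a^j = - b^i] and [a^j != - a^i] ([lucas_sol_distinct]); for
    [a = b] they say that [i + j] vanishes in the field, [i] does not, and
    [a^j = - a^i] ([lucas_sol_double]). Over the field with [p] elements there are
    three possibilities ([lucas_sol_Fp]): [a] and [b] are distinct elements of the
    field, or they coincide, or [b = a^p] is the conjugate of [a] in the quadratic
    extension. They correspond to (I)-(III), to (IV) and to (V), respectively.

    Since [-1] is the half-th power of a primitive root of unity of even order [n],
    taking exponents turns each case into linear congruences modulo [n] with
    right-hand side [h = n / 2]. The congruence [a s = h] is solvable exactly when
    [s] has smaller dyadic valuation than [n], and all its solutions satisfy
    [a d = h] exactly when [d] is an odd multiple of [gcd(s, n)]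
    ([half_cong_distinctP]). With [s = j - i p], [d = j - i] and [n = p^2 - 1] this
    is (V), once its inequality and its gcd are simplified ([nu2_lt_addr_min],
    [gcdz_absorb]). For eigenvalues in the prime field there are two unknown
    exponents modulo [n = p - 1]. If the valuation of [j - i] is at least that of
    [p - 1], a solution exists unless the power of two in [p - 1] divides [i], which
    is (I) or (II) ([nu2_I_or_II]); otherwise the second unknown only lifts the
    restriction on the valuation of [s = i + j], which leaves (III)
    ([split_congP], [odd_multiple_gcdl]). *)

(** * Homomorphisms from the algebra to matrices *)

(** The universal property of the quotient ring: the kernel of [f] is a two-sided
    ideal containing [G], hence it contains the ideal that [G] generates. *)
Lemma quot_ring_lift (R : nzRingType) (G : seq R) (S : nzRingType)
    (f : {rmorphism R -> S}) :
  (forall g, g \in G -> f g = 0) -> inhabited {rmorphism quot_ring G -> S}.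
Proof.
move=> fG.
have f_ideal u : u \in gen_ideal G -> f u = 0.
  move=> /asboolP/(_ (fun u => f u = 0)); apply=> //.
  split=> [|u' v fu fv|a b u' fu].
  - exact: rmorph0.
  - by rewrite rmorphB fu fv subrr.
  - by rewrite !rmorphM fu mulr0 mul0r.
have f_repr u : f (repr (\pi_(quot_ring G) u)%qT) = f u.
  apply/eqP; rewrite -subr_eq0 -rmorphB; apply/eqP/f_ideal.
  by rewrite -quot_eqE reprK.
pose F (q : quot_ring G) := f (repr q).
have FB : zmod_morphism F.
  move=> q1 q2; rewrite /F -rmorphB -[RHS]f_repr; congr (f (repr _)).
  by rewrite -{1}[q1]reprK -{1}[q2]reprK !piE.
have FM : monoid_morphism F.
  split=> [|q1 q2]; rewrite /F.
    by rewrite -[RHS](rmorph1 f) -[RHS]f_repr; congr (f (repr _)); rewrite !piE.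
  rewrite -rmorphM -[RHS]f_repr; congr (f (repr _)).
  by rewrite -{1}[q1]reprK -{1}[q2]reprK !piE.
pose aF := GRing.isZmodMorphism.Build _ _ F FB.
pose mF := GRing.isMonoidMorphism.Build _ _ F FM.
by exists; exact: (HB.pack F aF mF).
Qed.

Lemma pi_rmorph (R : nzRingType) (G : seq R) :
  exists P : {rmorphism R -> quot_ring G}, forall g, g \in G -> P g = 0.
Proof.
pose P u : quot_ring G := (\pi u)%qT.
have PB : zmod_morphism P by move=> u v; rewrite /P !piE.
have PM : monoid_morphism P by split=> [|u v]; rewrite /P !piE.
pose aP := GRing.isZmodMorphism.Build _ _ P PB.
pose mP := GRing.isMonoidMorphism.Build _ _ P PM.
pose PP : {rmorphism R -> quot_ring G} := HB.pack P aP mP.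
exists PP => g Gg; apply/eqP.
change (P g == 0); rewrite /P -(raddf0 PP) /= /P quot_eqE subr0.
exact: mem_gen_ideal.
Qed.

(** The universal property of the free algebra, for matrix targets: a word is sent
    to the corresponding product of [x] and [y]. *)
Lemma free_alg2_eval (k : fieldType) n (x y : 'M[k]_n.+1) :
  exists f : {rmorphism free_alg2 k -> 'M[k]_n.+1},
    f (freeX k) = x /\ f (freeY k) = y.
Proof.
pose h (m : fmonom bool) : 'M[k]_n.+1 :=
  \prod_(b <- m : seq bool) if b then x else y.
have hM : mmorphism h.
  split=> [m1 m2|]; last by rewrite /h fm1 big_nil.
  by rewrite /h -big_cat [mul m1 m2]fmmulE.
pose mh := isMultiplicative.Build _ _ h hM.
pose H : MMorphism.type (fmonom bool) 'M[k]_n.+1 := HB.pack h mh.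
pose c : {rmorphism k -> 'M[k]_n.+1} := scalar_mx.
pose F : free_alg2 k -> 'M[k]_n.+1 := mmap c H.
have FM : monoid_morphism F.
  (* The target is not commutative, but its scalar matrices are central. *)
  have [] := @commr_mmap_is_multiplicative _ _ _ c H.
    by move=> g m m'; rewrite /GRing.comm /= -!mulmxE scalar_mxC.
  by split.
have FB : zmod_morphism F by apply: mmap_is_additive.
pose aF := GRing.isZmodMorphism.Build _ _ F FB.
pose mF := GRing.isMonoidMorphism.Build _ _ F FM.
pose FF : {rmorphism free_alg2 k -> 'M[k]_n.+1} := HB.pack F aF mF.
exists FF; split.
  by rewrite /= /F /freeX mmapU /= /h fmuE big_seq1 mul1r.
by rewrite /= /F /freeY mmapU /= /h fmuE big_seq1 mul1r.
Qed.

Lemma rmorph_relation (R S : pzRingType) (f : {rmorphism R -> S}) i j x y :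
  f (x ^+ i * y + y * x ^+ j - 1) = f x ^+ i * f y + f y * f x ^+ j - 1.
Proof. by rewrite rmorphB rmorphD !rmorphM !rmorphXn rmorph1. Qed.

Lemma in_A11P (k : fieldType) (i j : nat) :
  in_A11 k i j <->
  exists x y : 'M[k]_2, x ^+ i * y + y * x ^+ j = 1 /\ y ^+ 2 = 0.
Proof.
rewrite /in_A11 /R11; set G := [:: _; _].
split=> [[f _]|[x [y [xy1 y0]]]].
  have [P PG] := pi_rmorph _ G.
  have P1 := PG _ (mem_head _ _).
  have P2 : P (freeY k ^+ 2) = 0 by apply: PG; rewrite inE mem_head orbT.
  rewrite rmorph_relation in P1; rewrite rmorphXn in P2.
  exists (f (P (freeX k))), (f (P (freeY k))); split.
    by apply/eqP; rewrite -subr_eq0 -rmorph_relation P1 rmorph0.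
  by rewrite -rmorphXn P2 rmorph0.
have [f [fx fy]] := free_alg2_eval k 1 x y.
have [|F] := @quot_ring_lift _ G _ f.
  move=> g; rewrite in_cons mem_seq1 => /orP[] /eqP ->.
    by rewrite rmorph_relation fx fy xy1 subrr.
  by rewrite rmorphXn fy.
by exists F, 1; rewrite rmorph1 oner_neq0.
Qed.

(** * Two by two matrices and Lucas sequences *)

Section Mx2.
Variable k : fieldType.
Implicit Types x y : 'M[k]_2.

Lemma mx2P x y :
  x 0 0 = y 0 0 -> x 0 1 = y 0 1 -> x 1 0 = y 1 0 -> x 1 1 = y 1 1 -> x = y.
Proof.
move=> e00 e01 e10 e11; apply/matrixP => a b.
have E (c : 'I_2) : c = 0 \/ c = 1.
  by case: c => [[|[|]]] // c; [left | right]; apply/val_inj.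
by case: (E a) => ->; case: (E b) => ->.
Qed.

Lemma mul_mx2E x y a b : (x * y) a b = x a 0 * y 0 b + x a 1 * y 1 b.
Proof.
rewrite -mulmxE mxE !big_ord_recl big_ord0 addr0.
by congr (_ * _ + x _ _ * y _ _); apply/val_inj.
Qed.

Lemma tr_mx2 x : \tr x = x 0 0 + x 1 1.
Proof.
rewrite /mxtrace !big_ord_recl big_ord0 addr0.
by congr (_ + x _ _); apply/val_inj.
Qed.

Lemma det_mx2 x : \det x = x 0 0 * x 1 1 - x 0 1 * x 1 0.
Proof.
rewrite (expand_det_row _ 0) !big_ord_recl big_ord0 addr0 /cofactor.
rewrite !det_mx11 !mxE /=.
rewrite expr0 mul1r expr1 mulN1r mulrN.
by congr (_ * x _ _ - x _ _ * x _ _); apply/val_inj.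
Qed.

Lemma Cayley_Hamilton_mx2 x : x * x = \tr x *: x - (\det x)%:A.
Proof.
by apply: mx2P; rewrite tr_mx2 det_mx2 !(mul_mx2E, mxE) /=; ring.
Qed.

(** The polarization of the Cayley-Hamilton identity; with [\tr y = 0] it turns the
    anticommutator of [x] and [y] into a multiple of [y] plus a scalar. *)
Lemma polar_Cayley_Hamilton_mx2 x y :
  x * y + y * x = \tr x *: y + \tr y *: x + (\tr (x * y) - \tr x * \tr y)%:A.
Proof.
by apply: mx2P; rewrite !tr_mx2 !(mul_mx2E, mxE) /=; ring.
Qed.
End Mx2.

Fixpoint lucasU (R : pzRingType) (T D : R) n : R :=
  if n is n'.+1 then
    if n' is m.+1 then T * lucasU R T D n' - D * lucasU R T D m else 1
  else 0.
Arguments lucasU {R} T D n : simpl never.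

Lemma lucasUS (R : pzRingType) (T D : R) n :
  lucasU T D n.+2 = T * lucasU T D n.+1 - D * lucasU T D n.
Proof. by []. Qed.

(** Reducing powers of [x] modulo its characteristic polynomial produces the Lucas
    sequence of its trace and determinant. *)
Lemma expr_mx2 (k : fieldType) (x : 'M[k]_2) n :
  let U := lucasU (\tr x) (\det x) in
  x ^+ n.+1 = U n.+1 *: x - (\det x * U n)%:A.
Proof.
move=> U; elim: n => [|n IH].
  by rewrite expr1 /U /= scale1r mulr0 scale0r subr0.
rewrite exprS IH mulrBr -scalerAr Cayley_Hamilton_mx2 /U lucasUS -/U.
apply: mx2P; rewrite !(mul_mx2E, mxE) /=; ring.
Qed.

(** The conditions on trace and determinant under which the matrix relations with
    exponents [i + 1] and [j + 1] are solvable; the shift avoids the index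
    [j - 1]. *)
Definition lucas_sol (R : pzRingType) (i j : nat) (T D : R) :=
  [/\ lucasU T D i.+1 = lucasU T D j.+1, lucasU T D i.+1 <> 0
    & lucasU T D i.+2 = D * lucasU T D j].

(** With [i], [j] for the exponents, multiplying [x^i y + y x^j = 1] by [y] on either
    side gives [y = y x^i y = U_i (y x y)] and [y = U_j (y x y)], so [U_i = U_j] is
    nonzero. The remaining condition is the coefficient of [y] in the relation. *)
Lemma mx2_relations_lucas (k : fieldType) (i j : nat) :
  (exists x y : 'M[k]_2, x ^+ i.+1 * y + y * x ^+ j.+1 = 1 /\ y ^+ 2 = 0) <->
  exists T D : k, lucas_sol k i j T D.
Proof.
split=> [[x [y [xy1]]]|[T [D [Uij /eqP U0 UD]]]].
  rewrite expr2 => yy0; exists (\tr x), (\det x).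
  rewrite /lucas_sol; set U := lucasU _ _.
  have y0 : y != 0.
    by apply: contra_eq_neq xy1 => ->; rewrite mulr0 mul0r addr0 eq_sym oner_neq0.
  (* A square-zero matrix of size 2 has trace 0. *)
  have try : \tr y = 0.
    have dy : \det y = 0.
      by apply/eqP; rewrite -[_ == 0]orbb -mulf_eq0 -det_mulmx mulmxE yy0 det0.
    have /esym/eqP := Cayley_Hamilton_mx2 k y; rewrite yy0 dy scale0r subr0.
    by rewrite scaler_eq0 (negPf y0) orbF => /eqP.
  have yxy (n : nat) : y * x ^+ n.+1 * y = U n.+1 *: (y * x * y).
    rewrite expr_mx2 mulrBr mulrBl -!scalerAr -!scalerAl mulr1.
    by rewrite yy0 scaler0 subr0.
  have yUi : y = U i.+1 *: (y * x * y).
    by rewrite -yxy -[LHS]mulr1 -xy1 mulrDr !mulrA yy0 mul0r addr0.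
  have yUj : y = U j.+1 *: (y * x * y).
    by rewrite -yxy -[LHS]mul1r -xy1 mulrDl -mulrA yy0 mulr0 add0r.
  have w0 : y * x * y != 0.
    by apply: contraNneq y0 => w0; rewrite yUi w0 scaler0.
  have UiUj : U i.+1 = U j.+1.
    apply/eqP; rewrite -subr_eq0 -[_ == 0]orbF -(negPf w0) -scaler_eq0.
    by rewrite scalerBl -yUi -yUj subrr.
  (* Substituting the expansions of the powers of x into the relation leaves a
     multiple of y on one side and a scalar matrix on the other; as y is
     nilpotent and nonzero, both must vanish. *)
  have e : (U i.+2 - \det x * U j) *: y = (1 - U i.+1 * \tr (x * y))%:A.
    rewrite [RHS]scalerBl scale1r -{1}xy1 !expr_mx2 -/U -UiUj mulrBl mulrBr.
    rewrite addrACA -!scalerAl -!scalerAr mul1r mulr1 -scalerDr.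
    rewrite polar_Cayley_Hamilton_mx2 try scale0r addr0 mulr0 subr0.
    by apply: mx2P; rewrite !(mul_mx2E, mxE) /U lucasUS /=; ring.
  have t1 : 1 - U i.+1 * \tr (x * y) = 0.
    have /eqP := congr1 (fun z => z * y) e.
    rewrite -!scalerAl mul1r yy0 scaler0 eq_sym scaler_eq0 (negPf y0) orbF.
    by move/eqP.
  split=> //.
    by apply/eqP; apply: contraNneq y0 => U0; rewrite yUi U0 scale0r.
  move/eqP: e; rewrite t1 scale0r scaler_eq0 (negPf y0) orbF subr_eq0.
  by move/eqP.
(* Conjugating y to the matrix unit, only the trace, the determinant and one
   entry of x matter; that entry has to be the inverse of U_i. *)
have [x [trx dx x10]] : exists x : 'M[k]_2,
    [/\ \tr x = T, \det x = D & x 1 0 = (lucasU T D i.+1)^-1].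
  pose c := (lucasU T D i.+1)^-1.
  exists (\matrix_(a, b) if a == 0 then (if b == 0 then T else - (D / c))
                         else (if b == 0 then c else 0)).
  rewrite tr_mx2 det_mx2 !mxE /=; split=> //; first by rewrite addr0.
  by rewrite mulr0 sub0r mulNr opprK divfK //; exact: invr_neq0.
exists x, (delta_mx 0 1); split; last first.
  by apply: mx2P; rewrite expr2 !(mul_mx2E, mxE) /=; ring.
move: UD; rewrite !expr_mx2 trx dx lucasUS => UD.
apply: mx2P; rewrite !(mul_mx2E, mxE) /= ?x10 -?Uij.
- by field.
- transitivity ((x 0 0 + x 1 1) * lucasU T D i.+1 - D * lucasU T D i
                - D * lucasU T D j).
    by ring.
  by rewrite -tr_mx2 trx UD subrr.
- by ring.
- by field.
Qed.

(** * Lucas sequences in terms of the eigenvalues *)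

Lemma lucasU_ind (R : pzRingType) (T D : R) (P : nat -> R -> Prop) :
  P 0 0 -> P 1 1 ->
  (forall n u v, P n u -> P n.+1 v -> P n.+2 (T * v - D * u)) ->
  forall n, P n (lucasU T D n).
Proof.
move=> P0 P1 PS n; suff [] : P n (lucasU T D n) /\ P n.+1 (lucasU T D n.+1) by [].
by elim: n => [|n [IH1 IH2]]; split=> //; exact: PS.
Qed.

Lemma lucasU_map (R S : pzRingType) (f : {rmorphism R -> S}) (T D : R) n :
  lucasU (f T) (f D) n = f (lucasU T D n).
Proof.
elim/lucasU_ind: n / (lucasU _ _ n) => [||n u v -> ->];
  rewrite ?rmorph0 ?rmorph1 //.
by rewrite lucasUS rmorphB !rmorphM.
Qed.

Lemma lucasU_roots (R : comPzRingType) (a b : R) n :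
  (a - b) * lucasU (a + b) (a * b) n = a ^+ n - b ^+ n.
Proof.
elim/lucasU_ind: n / (lucasU _ _ n) => [||n u v Hu Hv].
- by rewrite mulr0 !expr0 subrr.
- by rewrite mulr1.
have -> : (a - b) * ((a + b) * v - a * b * u)
    = (a + b) * ((a - b) * v) - a * b * ((a - b) * u) by ring.
by rewrite Hu Hv !exprS; ring.
Qed.

Lemma lucasU_double (R : comPzRingType) (a : R) n :
  a * lucasU (a + a) (a * a) n = n%:R * a ^+ n.
Proof.
elim/lucasU_ind: n / (lucasU _ _ n) => [||n u v Hu Hv].
- by rewrite mulr0 mul0r.
- by rewrite mul1r mulr1.
have -> : a * ((a + a) * v - a * a * u)
    = (a + a) * (a * v) - a * a * (a * u) by ring.
by rewrite Hu Hv !exprS -addn2 -addn1 !natrD; ring.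
Qed.

Lemma lucas_sol_map (F : fieldType) (S : nzRingType) (f : {rmorphism F -> S})
    i j T D :
  lucas_sol _ i j (f T) (f D) <-> lucas_sol _ i j T D.
Proof.
rewrite /lucas_sol !lucasU_map -rmorphM -(rmorph0 f).
have fi := fmorph_inj f.
split=> [[/fi ? ne /fi ?]|[-> ne ->]]; split=> // e; apply: ne; last exact: fi.
by rewrite e.
Qed.

(** Times [a - b], the equation [U_i = U_j] says [a^i + b^j = a^j + b^i], and then
    [U_(i+1) = D U_(j-1)] says that [a - b] times this common value is zero. *)
Lemma lucas_sol_distinct (F : fieldType) i j (a b : F) : a != b ->
  lucas_sol _ i j (a + b) (a * b) <->
  [/\ a ^+ i.+1 = - b ^+ j.+1, a ^+ j.+1 = - b ^+ i.+1 & a ^+ j.+1 <> - a ^+ i.+1].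
Proof.
rewrite -subr_eq0 => ab.
have E1 : lucasU (a + b) (a * b) i.+1 = lucasU (a + b) (a * b) j.+1 <->
    a ^+ i.+1 - b ^+ i.+1 = a ^+ j.+1 - b ^+ j.+1.
  by rewrite -!lucasU_roots; split=> [->|/(mulfI ab)].
have E2 : lucasU (a + b) (a * b) i.+1 = 0 <-> a ^+ i.+1 - b ^+ i.+1 = 0.
  rewrite -!lucasU_roots; split=> [->|/eqP]; first by rewrite mulr0.
  by rewrite mulf_eq0 (negPf ab) => /eqP.
have E3 : lucasU (a + b) (a * b) i.+2 = a * b * lucasU (a + b) (a * b) j <->
    a * (a ^+ i.+1 + b ^+ j.+1) - b * (b ^+ i.+1 + a ^+ j.+1) = 0.
  have -> : a * (a ^+ i.+1 + b ^+ j.+1) - b * (b ^+ i.+1 + a ^+ j.+1) =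
    (a ^+ i.+2 - b ^+ i.+2) - a * b * (a ^+ j - b ^+ j) by rewrite !exprS; ring.
  rewrite -!lucasU_roots mulrCA -mulrBr.
  split=> [->|/eqP]; first by rewrite subrr mulr0.
  by rewrite mulf_eq0 (negPf ab) subr_eq0 => /eqP.
rewrite /lucas_sol.
set x := a ^+ i.+1 in E1 E2 E3 *; set y := b ^+ i.+1 in E1 E2 E3 *.
set z := a ^+ j.+1 in E1 E2 E3 *; set w := b ^+ j.+1 in E1 E2 E3 *.
split=> [[/E1 e1 e2 /E3 e3]|[e1 e2 e3]].
  have e4 : z + y = x + w by rewrite -[x](subrK y) e1; ring.
  have xw : x + w = 0.
    apply/eqP; rewrite -[_ == 0]orFb -(negPf ab) -mulf_eq0 mulrBl -{2}e4 addrC.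
    by rewrite -e3; apply/eqP; ring.
  split; first by apply/eqP; rewrite -addr_eq0 xw.
    by apply/eqP; rewrite -addr_eq0 e4 xw.
  move=> zx; apply/e2/E2; rewrite e1 zx; apply/eqP.
  by rewrite subr_eq0 eq_sym -addr_eq0 addrC xw.
split; first by apply/E1; rewrite e1 e2; ring.
  move/E2 => /subr0_eq xy; apply: e3; rewrite e2 xy //.
by apply/E3; rewrite e1 e2; ring.
Qed.

(** Here [a U_n = n a^n], so that derivatives of powers replace differences and the
    characteristic of the field enters. *)
Lemma lucas_sol_double (F : fieldType) i j (a : F) : a != 0 ->
  lucas_sol _ i j (a + a) (a * a) <->
  [/\ (i.+1 + j.+1)%:R = 0 :> F, i.+1%:R <> 0 :> F & a ^+ j.+1 = - a ^+ i.+1].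
Proof.
move=> a0; have aI := mulfI a0.
have x0 : a ^+ i.+1 != 0 by rewrite expf_neq0.
rewrite /lucas_sol.
have E1 : lucasU (a + a) (a * a) i.+1 = lucasU (a + a) (a * a) j.+1 <->
    i.+1%:R * a ^+ i.+1 = j.+1%:R * a ^+ j.+1.
  by rewrite -!lucasU_double; split=> [->|/aI].
have E2 : lucasU (a + a) (a * a) i.+1 = 0 <-> i.+1%:R = 0 :> F.
  split=> [U0|i0].
    apply/eqP; rewrite -[_ == 0]orbF -(negPf x0) -mulf_eq0 -lucasU_double U0.
    by rewrite mulr0.
  by apply: aI; rewrite lucasU_double i0 mul0r mulr0.
have E3 : lucasU (a + a) (a * a) i.+2 = a * a * lucasU (a + a) (a * a) j <->
    i.+2%:R * a ^+ i.+1 = j%:R * a ^+ j.+1.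
  split=> [e|e].
    by apply: aI; rewrite [a * (i.+2%:R * _)]mulrCA -exprS -lucasU_double e
      -mulrA lucasU_double exprS; ring.
  apply: aI; rewrite lucasU_double exprS mulrCA e -mulrA lucasU_double exprS.
  by ring.
set x := a ^+ i.+1 in E1 x0 E3 *; set z := a ^+ j.+1 in E1 E3 *.
split=> [[/E1 e1 e2 /E3 e3]|[e1 e2 e3]].
  have zx : z = - x.
    transitivity (j.+1%:R * z - j%:R * z); first by rewrite -addn1 natrD; ring.
    by rewrite -e1 -e3 -(addn1 i.+1) [(_ + 1)%:R]natrD; ring.
  split=> //; last by move/E2.
  apply/eqP; rewrite -[_ == 0]orbF -(negPf x0) -mulf_eq0 natrD mulrDl e1 zx.
  by apply/eqP; ring.
have j1 : j.+1%:R = - i.+1%:R :> F by apply/eqP; rewrite -addr_eq0 addrC -natrD e1.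
split; first by apply/E1; rewrite j1 e3; ring.
  by move/E2.
apply/E3; have -> : j%:R = j.+1%:R - 1 :> F by rewrite -addn1 natrD; ring.
by rewrite j1 e3 -(addn1 i.+1) natrD; ring.
Qed.

(** * Roots of unity and roots of quadratics over finite fields *)

(** With [D = 0] the sequence is [U_(n+1) = T^n], which only leaves [T = 0] and the
    exponents [1, 1]; these are also solved by [T = 0], [D = 1]. *)
Lemma lucas_sol_D_neq0 (F : fieldType) i j (T D : F) : lucas_sol _ i j T D ->
  exists T' D', D' != 0 /\ lucas_sol F i j T' D'.
Proof.
have [-> [Uij U0 UD]|D0 s] := eqVneq D 0; last by exists T, D.
have U_T n : lucasU T 0 n.+1 = T ^+ n.
  elim: n => [|n IH]; first by [].
  by rewrite lucasUS IH mul0r subr0 exprS.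
move: Uij U0 UD; rewrite !U_T mul0r => Uij U0 /eqP.
rewrite expf_eq0 => /andP[_ /eqP T0].
move: Uij U0; rewrite T0 !expr0n; case: i => [|i]; last by move=> _ [].
case: j => [|j]; last by move=> -> [].
move=> _ _; exists 0, 1; split; first exact: oner_neq0.
split=> //; first by apply/eqP/oner_neq0.
by rewrite lucasUS !mul0r mulr0 subr0.
Qed.

(** A splitting field of [('X^N - 1) * q] contains both kinds of roots. Having them
    in one field makes a root of [q] a power of [z] once its order divides [N]. *)
Lemma prim_root_ext (F : finFieldType) N (q : {poly F}) :
  (0 < N)%N -> N%:R != 0 :> F -> (1 < size q)%N ->
  exists (L : fieldExtType F) (z a : L),
    N.-primitive_root z /\ root (map_poly (in_alg L) q) a.
Proof.
move=> N0 NF q1.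
have q0 : q != 0 by apply: contraTneq q1 => ->; rewrite size_poly0.
have XN0 : 'X^N - 1 != 0 :> {poly F} by rewrite -size_poly_gt0 size_XnsubC.
have [|L [rs splitL _]] := @FinSplittingFieldFor _ (('X^N - 1) * q).
  by rewrite mulf_neq0.
rewrite rmorphM /= in splitL.
have dv (f g : {poly L}) : f * g %= \prod_(r <- rs) ('X - r%:P) ->
    exists m, f %= \prod_(r <- mask m rs) ('X - r%:P).
  move=> e; have [|m fm] := @dvdp_prod_XsubC _ _ rs id f; last by exists m.
  by rewrite -(eqp_dvdr _ e) dvdp_mulIl.
have [m1 e1] := dv _ _ splitL.
have [m2 e2] : exists m,
    map_poly (in_alg L) q %= \prod_(r <- mask m rs) ('X - r%:P).
  by apply: (dv _ (map_poly (in_alg L) ('X^N - 1))); rewrite mulrC.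
rewrite rmorphB rmorphXn /= map_polyX rmorph1 in e1.
set s1 := mask m1 rs in e1; set s2 := mask m2 rs in e2.
have NL : N%:R != 0 :> L by rewrite -(rmorph_nat (in_alg L)) fmorph_eq0.
have /hasP[z _ z_prim] : has N.-primitive_root s1.
  apply: has_prim_root => //.
  - apply/allP=> r; rewrite -root_prod_XsubC -(eqp_root e1) //.
  - rewrite -separable_prod_XsubC -(eqp_separable e1).
    by rewrite cyclotomic.separable_Xn_sub_1.
  - by rewrite -ltnS -(size_prod_XsubC s1 id) -(eqp_size e1) size_XnsubC.
have [a as2] : exists a, a \in s2.
  case: s2 e2 => [|a s] e2; last by exists a; rewrite mem_head.
  move/eqp_size: e2; rewrite big_nil size_poly1 size_map_poly => e.
  by rewrite e in q1.
exists L, z, a; split=> //.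
by rewrite (eqp_root e2) root_prod_XsubC.
Qed.

Lemma prim_root_Fp (p : nat) : prime p -> exists z : 'F_p, p.-1.-primitive_root z.
Proof.
move=> pp; pose rs := [seq x <- enum 'F_p | x != 0].
have /hasP[z _ zp] : has p.-1.-primitive_root rs; last by exists z.
apply: has_prim_root.
- by rewrite -ltnS prednK ?prime_gt1 ?prime_gt0.
- apply/allP => x; rewrite mem_filter => /andP[x0 _].
  rewrite unity_rootE; apply/eqP/(mulIf x0).
  rewrite -exprSr prednK ?prime_gt0 // mul1r -[RHS]expf_card card_Fp //.
- by rewrite filter_uniq ?enum_uniq.
- have := cardC1 (0 : 'F_p); rewrite card_Fp // => <-.
  by rewrite cardE /rs enumT; apply: eq_leq; congr size.
Qed.

(** * Where the eigenvalues live *)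

(** The eigenvalue form of [lucas_sol] for distinct eigenvalues. The last clause
    makes [a] and [b] distinct and stands for the condition that the Lucas sequence
    does not vanish at the exponents. *)
Definition root_pair (R : pzRingType) (i j : nat) (a b : R) :=
  [/\ a ^+ i.+1 = - b ^+ j.+1, a ^+ j.+1 = - b ^+ i.+1 & a ^+ j.+1 <> - a ^+ i.+1].

Lemma root_pair_sol (F : fieldType) i j (a b : F) :
  root_pair F i j a b -> lucas_sol F i j (a + b) (a * b).
Proof.
move=> ab; apply/lucas_sol_distinct => //; apply/eqP => e.
by case: ab => [_]; rewrite -e.
Qed.

Section Fp.
Variables (p : nat) (pp : prime p).
Let F := 'F_p.

Lemma natr_pred_sqr_neq0 : (p ^ 2).-1%:R != 0 :> F.
Proof.
have : (p ^ 2).-1.+1%:R = 0 :> F.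
  by rewrite prednK ?expn_gt0 ?prime_gt0 // natrX pchar_Fp_0 // expr0n.
rewrite -addn1 natrD => /eqP; rewrite addr_eq0 => /eqP ->.
by rewrite oppr_eq0 oner_eq0.
Qed.

Lemma in_algP (L : fieldExtType F) (a : L) :
  reflect (exists c : F, a = in_alg L c) (a ^+ p == a).
Proof.
have := @Fermat's_little_theorem F L 1%AS a.
rewrite dimv1 expn1 card_Fp // => <-.
by apply: (iffP (vlineP _ _)).
Qed.

Lemma in_alg_Frobenius (L : fieldExtType F) (c : F) :
  (in_alg L c) ^+ p = in_alg L c.
Proof. by apply/eqP/in_algP; exists c. Qed.

Lemma Frobenius_rmorph (L : fieldExtType F) :
  exists f : {rmorphism L -> L}, forall a, f a = a ^+ p.
Proof.
have pL : p \in [pchar L] by rewrite pchar_lalg pchar_Fp.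
by exists (pFrobenius_aut pL).
Qed.

(** The eigenvalues are distinct in the prime field, or equal, or conjugate over it.
    In the last case Frobenius exchanges them, whence [a^(p^2 - 1) = 1]. *)
Lemma sol_root_cases i j (T D : F) : D != 0 -> lucas_sol F i j T D ->
  [\/ exists a b : F, [/\ a != 0, b != 0 & root_pair F i j a b],
      exists a : F, [/\ a != 0, (p %| i.+1 + j.+1)%N, ~~ (p %| i.+1)%N
                      & a ^+ j.+1 = - a ^+ i.+1]
    | exists (L : fieldExtType F) (z : L) (a : nat),
       (p ^ 2).-1.-primitive_root z /\ root_pair L i j (z ^+ a) (z ^+ a ^+ p)].
Proof.
move=> D0 sol.
pose q : {poly F} := 'X^2 - T *: 'X + D%:P.
have sq : size q = 3.
  rewrite /q -addrA size_polyDl size_polyXn // ltnS (leq_trans (size_polyD _ _)) //.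
  rewrite geq_max size_polyN (leq_trans (size_scale_leq _ _)) ?size_polyX //.
  by rewrite (leq_trans (size_polyC_leq1 _)).
have p1 := prime_gt1 pp; have p0 := prime_gt0 pp.
have N0 : (0 < (p ^ 2).-1)%N by rewrite -ltnS prednK ?expn_gt0 ?p0 // (ltn_exp2l 0).
have [||L [z [a [zP]]]] := @prim_root_ext F (p ^ 2).-1 q N0; rewrite ?sq //.
  exact: natr_pred_sqr_neq0.
rewrite /root /q !rmorphD rmorphN /= map_polyXn map_polyZ map_polyX map_polyC /=.
rewrite !hornerE /= => qa.
pose f := in_alg L; pose b := f T - a.
have Tab : f T = a + b by rewrite /b addrC subrK.
have Dab : f D = a * b.
  by apply/eqP; rewrite -subr_eq0 -(eqP qa) /b; apply/eqP; rewrite /f /=; ring.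
have solL : lucas_sol L i j (a + b) (a * b).
  by rewrite -Tab -Dab; apply/lucas_sol_map.
have ab0 : a * b != 0 by rewrite -Dab fmorph_eq0.
(* Either a lies in the prime field, and so does b, or the Frobenius
   automorphism exchanges a and b. *)
have [/in_algP[c ac]|] := boolP (a ^+ p == a).
  pose d := T - c.
  have Tcd : T = c + d by rewrite /d addrC subrK.
  have Dcd : D = c * d.
    apply: (fmorph_inj (in_alg L)); transitivity (a * b) => //.
    by rewrite /b ac -rmorphB -rmorphM.
  have [c0 d0] : c != 0 /\ d != 0 by apply/andP; rewrite -negb_or -mulf_eq0 -Dcd.
  rewrite Tcd Dcd in sol.
  have [cd|cd] := eqVneq c d.
    rewrite -cd in sol; apply: Or32; exists c.
    have /lucas_sol_double[] := sol => // ij0 i0 e.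
    by split=> //; rewrite (dvdn_pcharf (pchar_Fp pp)); apply/eqP.
  by apply: Or31; exists c, d; split=> //; apply/lucas_sol_distinct.
move=> ap; apply: Or33.
have [phi phiE] := Frobenius_rmorph L.
have phiF c : phi (f c) = f c by rewrite phiE in_alg_Frobenius.
have phia : phi a = b.
  have /eqP : (phi a - a) * (phi a - b) = 0.
    transitivity (phi (a * a - f T * a + f D)).
      by rewrite rmorphD rmorphB !rmorphM !phiF Tab Dab; ring.
    by rewrite Tab Dab (_ : _ + _ = 0) ?rmorph0 //; ring.
  by rewrite mulf_eq0 !subr_eq0 phiE (negPf ap) => /eqP.
have phib : phi b = a by rewrite /b rmorphB phiF phia Tab addrK.
have a0 : a != 0 by apply: contraNneq ab0 => ->; rewrite mul0r.
have aN : a ^+ (p ^ 2).-1 = 1.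
  apply: (mulIf a0); rewrite -exprSr prednK ?expn_gt0 ?p0 // mul1r.
  by rewrite expnS expn1 exprM -!phiE phia phib.
have [e ae] := prim_rootP zP aN.
exists L, z, e; split=> //; rewrite -ae -phiE phia.
apply/lucas_sol_distinct => //.
by rewrite -phia phiE eq_sym.
Qed.

(** The sum and the product of [a] and its conjugate [a ^+ p] are fixed by the
    Frobenius automorphism, so they descend to the prime field. *)
Lemma root_pair_sol_F (L : fieldExtType F) i j (a : L) :
  a ^+ (p ^ 2).-1 = 1 -> root_pair L i j a (a ^+ p) ->
  exists T D : F, lucas_sol F i j T D.
Proof.
move=> aN /root_pair_sol.
have [phi phiE] := Frobenius_rmorph L.
have pa2 : phi (phi a) = a.
  rewrite !phiE -exprM mulnn -[(p ^ 2)%N]prednK ?expn_gt0 ?prime_gt0 //.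
  by rewrite exprS aN mulr1.
rewrite -phiE => sol.
have [c cE] : exists c : F, a + phi a = in_alg L c.
  by apply/in_algP; rewrite -phiE rmorphD /= pa2 addrC.
have [d dE] : exists c : F, a * phi a = in_alg L c.
  by apply/in_algP; rewrite -phiE rmorphM /= pa2 mulrC.
rewrite cE dE in sol.
by exists c, d; apply/(lucas_sol_map F L (in_alg L)).
Qed.

End Fp.

(** * Congruences modulo an even number with half of it on the right *)

Lemma oddzP (c : int) : reflect (exists e, c = 2 * e + 1) (~~ (2 %| c)%Z).
Proof.
apply: (iffP idP) => [c2|[e ->]]; last by lia.
by exists (c %/ 2)%Z; lia.
Qed.

Lemma oddzM (a b : int) : ~~ (2 %| a * b)%Z = ~~ (2 %| a)%Z && ~~ (2 %| b)%Z.
Proof. by rewrite !dvdzE abszM (Euclid_dvdM _ _ (isT : prime 2)) negb_or. Qed.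

Lemma Bezout_odd (x s y e : int) : x * s + y * (2 * e) = 1 -> ~~ (2 %| x)%Z.
Proof.
move=> xs; apply/negP => /dvdzP[w xE].
have : (2 %| x * s + y * (2 * e))%Z.
  by apply/dvdzP; exists (w * s + y * e); rewrite xE; ring.
by rewrite xs.
Qed.

(** Throughout, [n = 2 h], and [Q] is the largest power of two dividing [n]: the
    condition [Q] does not divide [s] reads that [s] has smaller dyadic valuation
    than [n]. Congruences modulo [n] with right-hand side [h] arise because the
    half-th power of a primitive [n]-th root of unity is [-1]. *)
Section HalfCongruence.
Variables (k : nat) (m : int).
Hypothesis m_odd : ~~ (2 %| m)%Z.
Let q : int := 2 ^+ k.
Let Q : int := 2 * q.
Let n : int := Q * m.
Let h : int := q * m.

Let q_neq0 : q != 0. Proof. by rewrite expf_neq0. Qed.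
Let m_neq0 : m != 0. Proof. by apply: contraNneq m_odd => ->; rewrite dvdz0. Qed.
Let h_neq0 : h != 0. Proof. by rewrite mulf_neq0. Qed.
Let nE : n = 2 * h. Proof. by rewrite /n /Q /h mulrA. Qed.
Let Qn : (Q %| n)%Z. Proof. exact: dvdz_mulr. Qed.

Lemma Q_cancel (u d : int) : ~~ (2 %| u)%Z -> (Q %| u * d)%Z = (Q %| d)%Z.
Proof.
move=> u2; apply: Gauss_dvdzr; rewrite /Q /q -exprS coprimezE abszX coprimeXl //.
by rewrite prime_coprime // -dvdzE.
Qed.

Lemma Qdvd_h : (Q %| h)%Z = false.
Proof. by rewrite /Q mulrC dvdz_mul2l // (negPf m_odd). Qed.

(** If [n / gcd(s, n)] were odd, [Q] would divide [gcd(s, n)], hence [s]. An even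
    cofactor makes [gcd(s, n)] a divisor of [h]. *)
Lemma gcd_even_cofactor (s : int) : ~~ (Q %| s)%Z ->
  exists g u v s' e : int, [/\ gcdz s n = g, g != 0, s = g * s',
    n = g * (2 * e) & g = u * s + v * n].
Proof.
move=> Qs; have [u [v gE]] := Bezoutz s n.
have /dvdzP[s' sE] := (dvdz_gcdl s n).
have /dvdzP[e nE'] := (dvdz_gcdr s n).
have e2 : (2 %| e)%Z.
  apply: contraNT Qs => e2; have := Qn; rewrite nE' Q_cancel //.
  by move/dvdz_trans; apply; apply: dvdz_gcdl.
have /dvdzP[e' eE] := e2.
exists (gcdz s n), u, v, s', e'; split=> //.
- by rewrite gcdz_eq0 negb_and nE mulf_neq0 ?orbT.
- by rewrite mulrC.
- by rewrite {1}nE' eE; ring.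
Qed.

Lemma half_cong_solvable (s : int) : ~~ (Q %| s)%Z -> exists a, (n %| a * s - h)%Z.
Proof.
move=> /gcd_even_cofactor[g [u [v [s' [e [_ g0 sE nE' gE]]]]]].
have hE : h = g * e by apply: (@mulfI _ 2) => //; rewrite -nE nE'; ring.
exists (e * u); apply/dvdzP; exists (- (e * v)).
by rewrite hE gE; ring.
Qed.

Lemma half_cong_ndvd (a s : int) : (n %| a * s - h)%Z -> ~~ (Q %| s)%Z.
Proof.
move=> ash; apply/negP => Qs; have := dvdz_trans Qn ash.
by rewrite rpredBl ?Qdvd_h // dvdz_mull //.
Qed.

(** The integer [c] is read off modulo 2, since [2 h = n]. *)
Lemma odd_hP (c : int) : (n %| c * h - h)%Z = ~~ (2 %| c)%Z.
Proof.
rewrite nE (_ : c * h - h = (c - 1) * h); last by ring.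
by rewrite dvdz_mul2r //; lia.
Qed.

(** Solutions of [a s = h] form a coset of the multiples of [n / gcd(s, n)]. All of
    them solve [a d = h] exactly when [gcd(s, n)] divides [d], so that [a d] does
    not depend on the solution, and the quotient is odd, so that this value is [h]. *)
Lemma half_cong_distinctP (s d : int) :
  (exists a, (n %| a * s - h)%Z /\ ~~ (n %| a * d - h)%Z) <->
  ~~ (Q %| s)%Z /\ ~ odd_multiple d (gcdz s n).
Proof.
split=> [[a [ash adh]]|[Qs od]].
  have Qs := half_cong_ndvd _ _ ash; split=> // -[c c2].
  have [g [u [v [s' [e [-> g0 sE nE' gE]]]]]] := gcd_even_cofactor _ Qs.
  move=> dE; case/negP: adh.
  have us' : u * s' + v * (2 * e) = 1.
    by apply: (mulfI g0); rewrite mulr1 [RHS]gE sE nE'; ring.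
  have u2 := Bezout_odd _ _ _ _ us'.
  have -> : a * d - h = c * u * (a * s - h) + a * c * v * n + (c * u * h - h).
    by rewrite dE gE; ring.
  apply: rpredD; last by rewrite odd_hP oddzM c2.
  by apply: rpredD; apply: dvdz_mull.
have [g [u [v [s' [e [gg g0 sE nE' gE]]]]]] := gcd_even_cofactor _ Qs.
rewrite gg in od.
have hE : h = g * e by apply: (@mulfI _ 2) => //; rewrite -nE nE'; ring.
have e0 : e != 0 by apply: contraNneq h_neq0 => e0; rewrite hE e0 mulr0.
(* Both a and a + n / gcd(s, n) = a + 2 e solve the congruence for s; if both
   solved it for d as well, gcd(s, n) would divide d with an odd quotient. *)
pose a := e * u.
have ash : (n %| a * s - h)%Z.
  by apply/dvdzP; exists (- (e * v)); rewrite /a hE gE; ring.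
have [adh|?] := boolP (n %| a * d - h)%Z; last by exists a.
exists (a + 2 * e); split.
  have -> : (a + 2 * e) * s - h = (a * s - h) + s' * n by rewrite sE nE'; ring.
  by apply: rpredD => //; apply: dvdz_mull.
apply/negP => adh'; apply: od.
have : (n %| 2 * e * d)%Z.
  have -> : 2 * e * d = ((a + 2 * e) * d - h) - (a * d - h) by ring.
  exact: rpredB.
rewrite nE' [2 * e * d]mulrC dvdz_mul2r ?mulf_neq0 // => /dvdzP[c dE].
exists c => //; have : (n %| u * c * h - h)%Z.
  by move: adh; rewrite dE /a hE; congr (_ %| _)%Z; ring.
by rewrite odd_hP oddzM => /andP[].
Qed.

(** In terms of [u = a + b], [s = j + i] and [d = j - i] the first two congruences
    read [u d = 0] and [a s - u i = h]. If [Q] divides [d], then [a d] differs from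
    [h] automatically and only solvability matters, which is decided at the prime 2.
    If [Q] does not divide [d], one may take [u = 0] unless [Q] divides [s], when a
    solution with [a = 0] exists; and when [d] is an odd multiple of [gcd(s, n)],
    the term [u i] does not affect the value of [a d]. *)
Lemma split_congP (i j : int) :
  (exists a b, [/\ (n %| a * i - b * j - h)%Z, (n %| a * j - b * i - h)%Z
     & ~~ (n %| a * (j - i) - h)%Z]) <->
  (Q %| j - i)%Z /\ ~~ (Q %| i)%Z \/
  ~~ (Q %| j - i)%Z /\ ~ odd_multiple (j - i) (gcdz (j + i) n).
Proof.
have explicit_sol : ~~ (Q %| i)%Z -> (Q %| j - i)%Z || (Q %| j + i)%Z ->
  exists a b, [/\ (n %| a * i - b * j - h)%Z, (n %| a * j - b * i - h)%Z
     & ~~ (n %| a * (j - i) - h)%Z].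
  (* Take a = 0 and b = m v, where v i = q modulo Q: the factor m deals with
     the odd part of n. *)
  move=> Qi Qsd; have [v vi] := half_cong_solvable _ Qi.
  have vq : (Q %| v * i - q)%Z.
    have -> : v * i - q = (v * i - h) + q * (m - 1) by rewrite /h; ring.
    apply: rpredD; first exact: dvdz_trans Qn vi.
    have /oddzP[t ->] := m_odd.
    by rewrite addrK /Q [2 * q]mulrC dvdz_mul2l // dvdz_mulr.
  have vd : (Q %| v * (j - i))%Z.
    case/orP: Qsd => [Qd|Qs]; first by rewrite dvdz_mull.
    have -> : v * (j - i) = v * (j + i) - (2 * (v * i - q) + Q) by rewrite /Q; ring.
    by apply: rpredB; [|apply: rpredD => //]; apply: dvdz_mull.
  have ni : (n %| - (m * v) * i - h)%Z.
    have -> : - (m * v) * i - h = - (m * (v * i - q)) - n by rewrite nE /h; ring.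
    by apply: rpredB => //; rewrite rpredN /n [Q * m]mulrC dvdz_mul2l.
  exists 0, (m * v); split.
  - have -> : 0 * i - m * v * j - h
      = (- (m * v) * i - h) - m * (v * (j - i)) by ring.
    by apply: rpredB => //; rewrite /n [Q * m]mulrC dvdz_mul2l.
  - by move: ni; congr (_ %| _)%Z; ring.
  rewrite mul0r sub0r rpredN; apply/negP => /(dvdz_trans Qn).
  by rewrite Qdvd_h.
split=> [[a [b [e1 e2 e3]]]|[[Qd Qi]|[Qd od]]].
- have ud : (n %| (a + b) * (j - i))%Z.
    have -> : (a + b) * (j - i) = (a * j - b * i - h) - (a * i - b * j - h) by ring.
    exact: rpredB.
  have [Qd|Qd] := boolP (Q %| j - i)%Z; [left|right]; split=> //.
    apply/negP => Qi; have Qj : (Q %| j)%Z by rewrite -[j](subrK i) rpredD.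
    have := dvdz_trans Qn e1; rewrite rpredBl ?Qdvd_h //.
    by apply: rpredB => //; apply: dvdz_mull.
  move=> [c c2 dE]; case/negP: e3.
  have Qs : ~~ (Q %| j + i)%Z.
    by apply: contraNN Qd => Qs; rewrite dE dvdz_mull // dvdz_gcd Qs Qn.
  have [g [x [y [s' [e [gg g0 sE nE' gE]]]]]] := gcd_even_cofactor _ Qs.
  rewrite gg in dE.
  have us' : x * s' + y * (2 * e) = 1.
    by apply: (mulfI g0); rewrite mulr1 [RHS]gE sE nE'; ring.
  have x2 := Bezout_odd _ _ _ _ us'.
  have u2 : (2 %| a + b)%Z.
    by apply: contraNT Qd => u2; rewrite -(Q_cancel _ _ u2) (dvdz_trans Qn).
  have /dvdzP[w uE] := u2.
  have [t cxE] : exists t, c * x = 2 * t + 1 by apply/oddzP; rewrite oddzM c2.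
  (* From a (j + i) = h + u i with u = a + b, and d = r s modulo n for the odd
     number r = c x, the claim a d = h comes down to r u i = 0; it holds because
     2 r u i = r u s - r u d = u d (1 - r) modulo 2 n, u being even. *)
  have eui : (n %| c * x * (a + b) * i)%Z.
    have -> : c * x * (a + b) * i = (- t) * ((a + b) * (j - i)) - w * c * y * n.
      apply: (@mulfI _ 2) => //.
      transitivity (c * x * (a + b) * (j + i) - c * x * (a + b) * (j - i)).
        by ring.
      have -> : c * x * (a + b) * (j + i) = (a + b) * (j - i) - (a + b) * c * y * n.
        by rewrite dE gE; ring.
      by rewrite cxE uE; ring.
    by apply: rpredB => //; apply: dvdz_mull.
  have -> : a * (j - i) - h = c * x * (a * j - b * i - h) + c * x * (a + b) * i
      + a * c * y * n + (c * x * h - h).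
    by rewrite dE gE; ring.
  apply: rpredD; last by rewrite odd_hP oddzM c2.
  by apply: rpredD; [apply: rpredD => //; apply: dvdz_mull|apply: dvdz_mull].
- by apply: explicit_sol; rewrite ?Qd.
have [Qs|Qs] := boolP (Q %| j + i)%Z.
  apply: explicit_sol; rewrite ?Qs ?orbT //; apply: contraNN Qd => Qi.
  have -> : j - i = j + i - 2 * i by ring.
  by apply: rpredB => //; apply: dvdz_mull.
have [a [e1 e2]] := proj2 (half_cong_distinctP (j + i) (j - i)) (conj Qs od).
exists a, (- a); split=> //.
  by move: e1; congr (_ %| _)%Z; ring.
by move: e1; congr (_ %| _)%Z; ring.
Qed.

(** When [Q] does not divide [d], the quotient of [d] by [gcd(d, n)] is odd. *)
Lemma odd_multiple_gcdl (g d : int) : ~~ (Q %| d)%Z -> (g %| n)%Z ->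
  odd_multiple (gcdz d n) g <-> odd_multiple d g.
Proof.
move=> Qd gn; have [f [x [y [d' [e [ff f0 dE nE' fE]]]]]] := gcd_even_cofactor _ Qd.
have d'2 : ~~ (2 %| d')%Z.
  apply: (Bezout_odd _ x y e); apply: (mulfI f0).
  by rewrite mulr1 [RHS]fE dE nE'; ring.
split=> [[c c2 cE]|[c c2 cE]].
  by exists (d' * c); rewrite ?oddzM ?d'2 // dE -ff cE; ring.
have g0 : g != 0 by apply: contraNneq Qd => g0; rewrite cE g0 mulr0 dvdz0.
have /dvdzP[t tE] : (g %| gcdz d n)%Z by rewrite dvdz_gcd gn cE dvdz_mull.
exists t => //; have : c = d' * t.
  by apply: (mulIf g0); rewrite -cE dE -ff tE; ring.
by move=> cd; move: c2; rewrite cd oddzM => /andP[].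
Qed.
End HalfCongruence.

(** * Dyadic valuations as divisibility by powers of two *)

Lemma dvdz_pow2 l (x : int) : (2 ^+ l %| x)%Z = (l%:Z%:E <= nu2 x)%E.
Proof.
rewrite /nu2; have [->|x0] := eqVneq x 0; first by rewrite dvdz0 leey.
by rewrite lee_fin lez_nat dvdzE abszX pfactor_dvdn // absz_gt0.
Qed.

Lemma nu2_gt l (x : int) : (l%:Z%:E < nu2 x)%E = (2 ^+ l.+1 %| x)%Z.
Proof.
rewrite dvdz_pow2 /nu2; have [_|x0] := eqVneq x 0; first by rewrite ltry leey.
by rewrite lee_fin lte_fin lez_nat ltz_nat.
Qed.

Lemma nu2_lt l (x : int) : (nu2 x < l%:Z%:E)%E = ~~ (2 ^+ l %| x)%Z.
Proof. by rewrite dvdz_pow2 ltNge. Qed.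

Lemma nu2_eq l (x : int) :
  nu2 x = l%:Z%:E <-> (2 ^+ l %| x)%Z && ~~ (2 ^+ l.+1 %| x)%Z.
Proof.
by rewrite dvdz_pow2 -nu2_gt -leNgt -eq_le; split=> [->|/eqP ->].
Qed.

Lemma nu2_pow l (m : int) : ~~ (2 %| m)%Z -> nu2 (2 ^+ l * m) = l%:Z%:E.
Proof.
move=> m2; apply/nu2_eq; rewrite dvdz_mulr //= exprSr dvdz_mul2l ?m2 //.
by rewrite expf_neq0.
Qed.

Lemma dyadic_split (n : int) :
  n != 0 -> exists k m, ~~ (2 %| m)%Z /\ n = 2 ^+ k * m.
Proof.
move=> n0; pose k := logn 2 `|n|%N.
have : nu2 n = k%:Z%:E by rewrite /nu2 (negPf n0).
move/nu2_eq => /andP[/dvdzP[m nE] nk]; exists k, m; rewrite mulrC -nE; split=> //.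
by apply: contraNN nk => m2; rewrite nE exprSr [m * _]mulrC dvdz_mul2l // expf_neq0.
Qed.

Lemma same_parity_sub (a b : int) : (2 %| a)%Z = (2 %| b)%Z -> (2 %| a - b)%Z.
Proof. lia. Qed.

(** Conditions (I) and (II) together, for [l] the valuation of [p - 1]: since
    [2 i = s - d], the number [2 ^ l] divides [i] exactly when [2 ^ (l + 1)] divides
    [s - d], and for a multiple [d] of [2 ^ l] this compares the parities of the
    quotients of [s] and [d]. *)
Lemma nu2_I_or_II l (i d s : int) : s = d + 2 * i ->
  ((nu2 d > l%:Z%:E)%E /\ (l%:Z%:E >= nu2 s)%E \/
   nu2 d = l%:Z%:E /\ l%:Z%:E <> nu2 s) <->
  (2 ^+ l %| d)%Z /\ ~~ (2 ^+ l %| i)%Z.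
Proof.
move=> sE; rewrite nu2_gt leNgt nu2_gt.
have eq_iff : l%:Z%:E <> nu2 s <-> ~~ ((2 ^+ l %| s)%Z && ~~ (2 ^+ l.+1 %| s)%Z).
  split=> [ne|/negP ne e]; last by apply/ne/nu2_eq.
  by apply/negP => /nu2_eq e; apply: ne.
rewrite nu2_eq eq_iff.
set Q : int := 2 ^+ l; have -> : 2 ^+ l.+1 = Q * 2 :> int by rewrite exprSr.
have Q0 : Q != 0 by rewrite expf_neq0.
have Qd : (Q * 2 %| d)%Z -> (Q %| d)%Z by apply: dvdz_trans; apply: dvdz_mulr.
have Qs : (Q * 2 %| s)%Z -> (Q %| s)%Z by apply: dvdz_trans; apply: dvdz_mulr.
have Qi : (Q %| i)%Z -> ((Q %| s) = (Q %| d))%Z /\ ((Q * 2 %| s) = (Q * 2 %| d))%Z.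
  move=> Qi; have Q2i : (Q * 2 %| 2 * i)%Z by rewrite [2 * i]mulrC dvdz_mul2r.
  by rewrite sE !rpredDr // dvdz_mull.
have iQ : (Q %| d)%Z -> (Q %| s)%Z -> ((Q * 2 %| s) = (Q * 2 %| d))%Z -> (Q %| i)%Z.
  move=> /dvdzP[d' dE] /dvdzP[s' s'E].
  have : 2 * i = Q * (s' - d') by rewrite mulrBr -[Q * s']mulrC -s'E sE dE; ring.
  rewrite s'E dE ![_ * Q]mulrC !dvdz_mul2l // => e par.
  have /dvdzP[w wE] : (2 %| s' - d')%Z by exact: same_parity_sub.
  apply/dvdzP; exists w; apply: (@mulfI _ 2) => //; rewrite e wE; ring.
move: Qd Qs Qi iQ; do 5!case: (boolP (_ %| _)%Z) => _; intuition congruence.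
Qed.

(** * From roots of unity to exponents *)

Lemma prim_root_neq0 (F : fieldType) (z : F) n : n.-primitive_root z -> z != 0.
Proof.
move=> zP; apply: contra_eq_neq (prim_expr_order zP) => ->.
by rewrite expr0n gtn_eqF ?(prim_order_gt0 zP) // eq_sym oner_neq0.
Qed.

(** [-1] is the [h]-th power of [z]. *)
Lemma prim_root_expr_opp (F : fieldType) (z : F) (h : nat) :
  (2 * h).-primitive_root z -> forall u v : nat,
  z ^+ u = - z ^+ v <-> ((2 * h)%N%:Z %| u%:Z - v%:Z - h%:Z)%Z.
Proof.
move=> zP u v; have N0 := prim_order_gt0 zP.
have h0 : (0 < h)%N by lia.
have zh : z ^+ h = -1.
  have /eqP : (z ^+ h) ^+ 2 = 1 by rewrite -exprM mulnC prim_expr_order.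
  rewrite sqrf_eq1 => /orP[|/eqP //].
  by rewrite -(prim_order_dvd zP) => /dvdn_leq; lia.
have -> : - z ^+ v = z ^+ (v + h) by rewrite exprD zh mulrN1.
apply: (iff_trans (rwP eqP)); rewrite (eq_prim_root_expr zP) -eqz_nat -!modz_nat.
by rewrite eqz_mod_dvd PoszD opprD addrA.
Qed.

Lemma natural_repr (n : nat) (a : int) :
  (0 < n)%N -> exists e : nat, (n%:Z %| e%:Z - a)%Z.
Proof.
move=> n0; exists `|(a %% n%:Z)%Z|%N.
rewrite gez0_abs ?modz_ge0 -?eqz_mod_dvd ?modz_mod //; lia.
Qed.

Lemma Fp_unit_expr (p : nat) (z a : 'F_p) : prime p -> p.-1.-primitive_root z ->
  a != 0 -> exists e : nat, a = z ^+ e.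
Proof.
move=> pp zP a0.
have [|e ->] := prim_rootP zP (_ : a ^+ p.-1 = 1); last by exists e.
apply/(mulIf a0); rewrite -exprSr prednK ?prime_gt0 // mul1r.
by rewrite -[RHS]expf_card card_Fp.
Qed.

(** Discrete logarithms with respect to a primitive root modulo [p]. *)
Lemma split_root_expr (p h i j : nat) : prime p -> p.-1 = (2 * h)%N ->
  (exists a b : 'F_p, [/\ a != 0, b != 0 & root_pair 'F_p i j a b]) <->
  exists a b : int, [/\ ((2 * h)%N%:Z %| a * i.+1%:Z - b * j.+1%:Z - h%:Z)%Z,
    ((2 * h)%N%:Z %| a * j.+1%:Z - b * i.+1%:Z - h%:Z)%Z &
    ~~ ((2 * h)%N%:Z %| a * (j.+1%:Z - i.+1%:Z) - h%:Z)%Z].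
Proof.
move=> pp ph; have [z] := prim_root_Fp p pp; rewrite ph => zP.
have opp := prim_root_expr_opp _ _ _ zP.
have key (e f : nat) : root_pair 'F_p i j (z ^+ e) (z ^+ f) <->
    [/\ ((2 * h)%N%:Z %| e%:Z * i.+1%:Z - f%:Z * j.+1%:Z - h%:Z)%Z,
    ((2 * h)%N%:Z %| e%:Z * j.+1%:Z - f%:Z * i.+1%:Z - h%:Z)%Z &
    ~~ ((2 * h)%N%:Z %| e%:Z * (j.+1%:Z - i.+1%:Z) - h%:Z)%Z].
  rewrite /root_pair -!exprM mulrBr -!PoszM.
  split=> -[/opp ? /opp ? ne]; split=> //; last by move/opp/(negP ne).
  by apply/negP => /opp /ne.
have z0 := prim_root_neq0 _ _ _ zP.
split=> [[a [b [a0 b0]]]|[a [b [e1 e2 e3]]]].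
  have [|e ->] := @Fp_unit_expr p z a pp _ a0; first by rewrite ph.
  have [|f ->] := @Fp_unit_expr p z b pp _ b0; first by rewrite ph.
  by move/key; exists e, f.
have [e ea] := natural_repr _ a (prim_order_gt0 zP).
have [f fb] := natural_repr _ b (prim_order_gt0 zP).
exists (z ^+ e), (z ^+ f); split; rewrite ?expf_neq0 //; apply/key.
set n : int := (2 * h)%N in e1 e2 e3 ea fb *.
split.
- have -> : e%:Z * i.+1%:Z - f%:Z * j.+1%:Z - h%:Z =
    (a * i.+1%:Z - b * j.+1%:Z - h%:Z)
    + (i.+1%:Z * (e%:Z - a) - j.+1%:Z * (f%:Z - b)) by ring.
  by rewrite rpredD // rpredB // dvdz_mull.
- have -> : e%:Z * j.+1%:Z - f%:Z * i.+1%:Z - h%:Z =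
    (a * j.+1%:Z - b * i.+1%:Z - h%:Z)
    + (j.+1%:Z * (e%:Z - a) - i.+1%:Z * (f%:Z - b)) by ring.
  by rewrite rpredD // rpredB // dvdz_mull.
have -> : e%:Z * (j.+1%:Z - i.+1%:Z) - h%:Z = (a * (j.+1%:Z - i.+1%:Z) - h%:Z)
    + (j.+1%:Z - i.+1%:Z) * (e%:Z - a) by ring.
by rewrite rpredDr // dvdz_mull.
Qed.

Lemma double_root_expr (p h i j : nat) : prime p -> p.-1 = (2 * h)%N ->
  (exists2 a : 'F_p, a != 0 & a ^+ j.+1 = - a ^+ i.+1) <->
  exists a : int, ((2 * h)%N%:Z %| a * (j.+1%:Z - i.+1%:Z) - h%:Z)%Z.
Proof.
move=> pp ph; have [z] := prim_root_Fp p pp; rewrite ph => zP.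
have opp := prim_root_expr_opp _ _ _ zP.
have key (e : nat) : z ^+ e ^+ j.+1 = - z ^+ e ^+ i.+1 <->
    ((2 * h)%N%:Z %| e%:Z * (j.+1%:Z - i.+1%:Z) - h%:Z)%Z.
  by rewrite -!exprM opp mulrBr -!PoszM.
have z0 := prim_root_neq0 _ _ _ zP.
split=> [[a a0]|[a ah]].
  have [|e ->] := @Fp_unit_expr p z a pp _ a0; first by rewrite ph.
  by move/key; exists e.
have [e ea] := natural_repr _ a (prim_order_gt0 zP).
exists (z ^+ e); rewrite ?expf_neq0 //; apply/key.
have -> : e%:Z * (j.+1%:Z - i.+1%:Z) - h%:Z = (a * (j.+1%:Z - i.+1%:Z) - h%:Z)
    + (j.+1%:Z - i.+1%:Z) * (e%:Z - a) by ring.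
by rewrite rpredD // dvdz_mull.
Qed.

(** * The criterion *)

Lemma odd_half_succ (p : nat) : odd p -> exists t : int, p%:Z = 2 * t - 1.
Proof.
by move=> odd_p; exists (p./2.+1)%:Z; have := odd_double_half p; rewrite odd_p; lia.
Qed.

(** Discrete logarithms with respect to a primitive root of unity of order
    [p^2 - 1], in an extension containing one. The Frobenius automorphism
    multiplies exponents by [p], so a single congruence remains next to the
    inequality. *)
Lemma nonsplit_root_expr (p h i j : nat) :
  prime p -> odd p -> (p ^ 2).-1 = (2 * h)%N ->
  (exists (L : fieldExtType 'F_p) (z : L) (a : nat),
     (p ^ 2).-1.-primitive_root z /\ root_pair L i j (z ^+ a) (z ^+ a ^+ p)) <->
  exists a : int, ((2 * h)%N%:Z %| a * (j.+1%:Z - i.+1%:Z * p%:Z) - h%:Z)%Z /\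
    ~~ ((2 * h)%N%:Z %| a * (j.+1%:Z - i.+1%:Z) - h%:Z)%Z.
Proof.
move=> pp odd_p ph; rewrite ph.
have key (L : fieldExtType 'F_p) (z : L) (e : nat) : (2 * h).-primitive_root z ->
  root_pair L i j (z ^+ e) (z ^+ e ^+ p) <->
  [/\ ((2 * h)%N%:Z %| e%:Z * (i.+1%:Z - p%:Z * j.+1%:Z) - h%:Z)%Z,
     ((2 * h)%N%:Z %| e%:Z * (j.+1%:Z - i.+1%:Z * p%:Z) - h%:Z)%Z &
     ~~ ((2 * h)%N%:Z %| e%:Z * (j.+1%:Z - i.+1%:Z) - h%:Z)%Z].
  move=> zP; have opp := prim_root_expr_opp _ _ _ zP.
  rewrite /root_pair -!exprM !mulrBr [i.+1%:Z * p%:Z]mulrC !mulrA -!PoszM.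
  split=> -[/opp ? /opp ? ne]; split=> //; last by move/opp/(negP ne).
  by apply/negP => /opp /ne.
split=> [[L [z [a [zP /(key _ _ _ zP)[_ e1 e2]]]]]|[a [e1 e2]]]; first by exists a.
have p2 : p%:Z ^+ 2 = 2 * h%:Z + 1.
  rewrite -PoszM -PoszD -ph addn1 prednK ?expn_gt0 ?prime_gt0 //; lia.
have N0 : (0 < 2 * h)%N.
  rewrite -ph -ltnS prednK ?expn_gt0 ?prime_gt0 //.
  by rewrite (ltn_exp2l 0) // prime_gt1.
have [||L [z [_ [zP _]]]] := @prim_root_ext 'F_p (2 * h) 'X N0;
  rewrite ?size_polyX //.
  by rewrite -ph natr_pred_sqr_neq0.
have [e ea] := natural_repr _ a N0.
exists L, z, e; split=> //; apply/key => //.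
set n : int := (2 * h)%N in e1 e2 ea *.
have nE : n = 2 * h%:Z by [].
have e3 : (n %| e%:Z * (j.+1%:Z - i.+1%:Z * p%:Z) - h%:Z)%Z.
  have -> : e%:Z * (j.+1%:Z - i.+1%:Z * p%:Z) - h%:Z =
    (a * (j.+1%:Z - i.+1%:Z * p%:Z) - h%:Z)
    + (j.+1%:Z - i.+1%:Z * p%:Z) * (e%:Z - a) by ring.
  by rewrite rpredD // dvdz_mull.
split=> //; last first.
  have -> : e%:Z * (j.+1%:Z - i.+1%:Z) - h%:Z = (a * (j.+1%:Z - i.+1%:Z) - h%:Z)
    + (j.+1%:Z - i.+1%:Z) * (e%:Z - a) by ring.
  by rewrite rpredDr // dvdz_mull.
have [t tE] : exists t : int, p%:Z = 2 * t - 1.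
  exact: odd_half_succ.
(* The two equations on z ^+ e are Frobenius conjugates of each other. *)
have -> : e%:Z * (i.+1%:Z - p%:Z * j.+1%:Z) - h%:Z =
  - (p%:Z * (e%:Z * (j.+1%:Z - i.+1%:Z * p%:Z) - h%:Z)) - (e%:Z * i.+1%:Z + t) * n.
  transitivity (- (p%:Z * (e%:Z * (j.+1%:Z - i.+1%:Z * p%:Z) - h%:Z))
     - (e%:Z * i.+1%:Z) * (p%:Z ^+ 2 - 1) - (p%:Z + 1) * h%:Z); first by ring.
  have -> : p%:Z + 1 = 2 * t by rewrite tE subrK.
  by rewrite p2 nE; ring.
by rewrite rpredB ?rpredN ?dvdz_mull.
Qed.

(** If the valuation of [d] is below [a], that of [x] agrees with it, as [x] and [d]
    are congruent modulo [2 ^ a]; then both sides hold because [b] is positive.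
    So the minimum in condition (V) amounts to the valuation of [p - 1]. *)
Lemma nu2_lt_addr_min (a b : nat) (x d : int) : (0 < b)%N -> (2 ^+ a %| x - d)%Z ->
  (nu2 x < b%:Z%:E + Order.min (nu2 d) a%:Z%:E)%E <-> ~~ (2 ^+ (a + b) %| x)%Z.
Proof.
move=> b0 xd; have [ad|da] := boolP (2 ^+ a %| d)%Z.
  have -> : Order.min (nu2 d) a%:Z%:E = a%:Z%:E.
    by apply/min_idPr; rewrite -dvdz_pow2.
  by rewrite -EFinD -PoszD addnC nu2_lt.
have d0 : d != 0 by apply: contraNneq da => ->; rewrite dvdz0.
have [c dc] : exists c : nat, nu2 d = c%:Z%:E by rewrite /nu2 (negPf d0); eexists.
have ca : (c < a)%N by move: da; rewrite -nu2_lt dc lte_fin ltz_nat.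
have -> : Order.min (nu2 d) a%:Z%:E = c%:Z%:E.
  by rewrite dc; apply/min_idPl; rewrite lee_fin lez_nat ltnW.
have dv l : (l <= a)%N -> (2 ^+ l %| x)%Z = (2 ^+ l %| d)%Z.
  move=> la; rewrite -[x in LHS](subrK d) rpredDl // (dvdz_trans _ xd) //.
  by apply: dvdz_exp2l.
have xc : nu2 x = c%:Z%:E.
  by apply/nu2_eq; move/nu2_eq: dc; rewrite !dv // ltnW.
rewrite xc -EFinD -PoszD lte_fin ltz_nat dvdz_pow2 xc lee_fin lez_nat.
by split=> _; lia.
Qed.

(** With [u = p + 1] and [v = i] the absorbed combination of [x = j - i p] and
    [N = p^2 - 1] is the entry [(p + 1) (j - i)] of the gcd in condition (V). *)
Lemma gcdz_absorb (x N u v : int) : gcdz (gcdz x (x * u + N * v)) N = gcdz x N.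
Proof.
rewrite [LHS]/gcdz [RHS]/gcdz; congr Posz; apply/eqP; rewrite eqn_dvd.
apply/andP; split.
  change (gcdz (gcdz x (x * u + N * v)) N %| gcdz x N)%Z.
  by rewrite dvdz_gcd (dvdz_trans (dvdz_gcdl _ _)) ?dvdz_gcdl ?dvdz_gcdr.
change (gcdz x N %| gcdz (gcdz x (x * u + N * v)) N)%Z.
by rewrite !dvdz_gcd rpredD ?dvdz_mulr ?dvdz_gcdl ?dvdz_gcdr.
Qed.

Lemma lucas_sol_Fp (p i j : nat) : prime p ->
  (exists T D : 'F_p, lucas_sol 'F_p i j T D) <->
  [\/ exists a b : 'F_p, [/\ a != 0, b != 0 & root_pair 'F_p i j a b],
      [/\ (p %| i.+1 + j.+1)%N, ~~ (p %| i.+1)%N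
        & exists2 a : 'F_p, a != 0 & a ^+ j.+1 = - a ^+ i.+1]
    | exists (L : fieldExtType 'F_p) (z : L) (a : nat),
       (p ^ 2).-1.-primitive_root z /\ root_pair L i j (z ^+ a) (z ^+ a ^+ p)].
Proof.
move=> pp; split=> [[T [D /lucas_sol_D_neq0[T' [D' [D0 sol]]]]]|].
  case: (sol_root_cases p pp i j T' D' D0 sol) => [S|[a [a0 ps pi e]]|N].
  - by apply: Or31.
  - by apply: Or32; split=> //; exists a.
  - by apply: Or33.
case=> [[a [b [_ _ ab]]]|[ps pi [a a0 e]]|[L [z [a [zP ab]]]]].
- by exists (a + b), (a * b); apply: root_pair_sol.
- exists (a + a), (a * a); apply/lucas_sol_double => //; split=> //.
    by apply/eqP; rewrite -(dvdn_pcharf (pchar_Fp pp)).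
  by apply/eqP; rewrite -(dvdn_pcharf (pchar_Fp pp)).
- by apply: root_pair_sol_F ab => //; rewrite exprAC (prim_expr_order zP) expr1n.
Qed.

Theorem theorem3p12 (p i j : nat) :
  prime p -> (3 <= p)%N -> (0 < i)%N -> (0 < j)%N ->
  in_A11 'F_p i j <->
  (* I *)
  ((nu2 (j%:Z - i%:Z) > nu2 (p%:Z - 1))%E /\
   (nu2 (p%:Z - 1) >= nu2 (i%:Z + j%:Z))%E) \/
  (* II *)
  (nu2 (j%:Z - i%:Z) = nu2 (p%:Z - 1) /\
   nu2 (p%:Z - 1) <> nu2 (i%:Z + j%:Z)) \/
  (* III *)
  ((nu2 (j%:Z - i%:Z) < nu2 (p%:Z - 1))%E /\
   ~ odd_multiple (gcdz (j%:Z - i%:Z) (p%:Z - 1))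
                  (gcdz (j%:Z + i%:Z) (p%:Z - 1))) \/
  (* IV *)
  [/\ (nu2 (j%:Z - i%:Z) < nu2 (p%:Z - 1))%E,
      (p %| i + j)%N & ~~ (p %| i)%N] \/
  (* V *)
  ((nu2 (j%:Z - i%:Z * p%:Z)
      < nu2 (p%:Z + 1) + Order.min (nu2 (j%:Z - i%:Z)) (nu2 (p%:Z - 1)))%E /\
   ~ odd_multiple (j%:Z - i%:Z)
       (gcdz (gcdz (j%:Z - i%:Z * p%:Z) ((p%:Z + 1) * (j%:Z - i%:Z)))
             (p%:Z ^+ 2 - 1))).
Proof.
move=> pp p3; case: i => // i; case: j => // j _ _.
have odd_p : odd p by case: (even_prime pp) => // p2; rewrite p2 in p3.
pose t := p./2; have pt : p = (2 * t).+1.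
  by rewrite -[LHS]odd_double_half odd_p -mul2n.
have t0 : t%:Z != 0 by lia.
have t1 : t%:Z + 1 != 0 by lia.
have pE : p%:Z = 2 * t%:Z + 1 by rewrite pt; lia.
pose hh := (2 * t * t.+1)%N.
have ph1 : p.-1 = (2 * t)%N by rewrite pt.
have ph2 : (p ^ 2).-1 = (2 * hh)%N by rewrite /hh pt; lia.
have hhE' : hh%:Z = 2 * t%:Z * (t%:Z + 1) by rewrite /hh; lia.
(* p - 1 = 2 t and p + 1 = 2 (t + 1) get the dyadic valuations k + 1 and l + 1. *)
have [k [m [m2 tE]]] := dyadic_split _ t0.
have [l [w [w2 t1E]]] := dyadic_split _ t1.
have mw2 : ~~ (2 %| m * w)%Z by rewrite oddzM m2.
have nE' : (2 * t)%N%:Z = 2 * 2 ^+ k * m by rewrite -mulrA -tE.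
have nE : p%:Z - 1 = 2 * 2 ^+ k * m by rewrite -mulrA -tE pE addrK.
have p1E : p%:Z + 1 = 2 ^+ l.+1 * w by rewrite exprS -mulrA -t1E pE; ring.
have hhE : hh%:Z = 2 ^+ (k + l).+1 * (m * w).
  by rewrite hhE' tE -tE t1E tE exprS exprD; ring.
have NE' : (2 * hh)%N%:Z = 2 * 2 ^+ (k + l).+1 * (m * w) by rewrite PoszM hhE mulrA.
have NE : p%:Z ^+ 2 - 1 = 2 * 2 ^+ (k + l).+1 * (m * w).
  by rewrite -NE' PoszM hhE' pE; ring.
have nun : nu2 (p%:Z - 1) = k.+1%:Z%:E by rewrite nE -exprS nu2_pow.
have nup : nu2 (p%:Z + 1) = l.+1%:Z%:E by rewrite p1E nu2_pow.
have Q2 : 2 ^+ k.+1 = 2 * 2 ^+ k :> int by rewrite exprS.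
set d : int := j.+1%:Z - i.+1%:Z.
have d_small : (nu2 d < nu2 (p%:Z - 1))%E = ~~ (2 * 2 ^+ k %| d)%Z.
  by rewrite nun nu2_lt Q2.
have split_iff := split_root_expr p t i j pp ph1.
rewrite nE' tE in split_iff.
have {}split_iff := iff_trans split_iff (split_congP k m m2 _ _).
have double_iff := double_root_expr p t i j pp ph1.
rewrite nE' tE in double_iff.
have nonsplit_iff := nonsplit_root_expr p hh i j pp odd_p ph2.
rewrite NE' hhE in nonsplit_iff.
have {}nonsplit_iff := iff_trans nonsplit_iff (half_cong_distinctP _ _ mw2 _ _).
rewrite -/d in split_iff double_iff nonsplit_iff.
have I_II := nu2_I_or_II k.+1 i.+1%:Z d (i.+1%:Z + j.+1%:Z).
rewrite Q2 -nun in I_II.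
have {}I_II := I_II ltac:(rewrite /d; ring).
have III := odd_multiple_gcdl k m m2 (gcdz (j.+1%:Z + i.+1%:Z) (p%:Z - 1)) d.
rewrite -nE in III.
have xd : (2 ^+ k.+1 %| (j.+1%:Z - i.+1%:Z * p%:Z) - d)%Z.
  have -> : (j.+1%:Z - i.+1%:Z * p%:Z) - d = - (i.+1%:Z * (p%:Z - 1)).
    by rewrite /d; ring.
  by rewrite rpredN nE Q2 dvdz_mull // dvdz_mulr.
have V_iff := nu2_lt_addr_min k.+1 l.+1 _ _ (ltn0Sn _) xd.
rewrite -nun -nup addSn addnS exprS in V_iff.
have gcdV :
    gcdz (gcdz (j.+1%:Z - i.+1%:Z * p%:Z) ((p%:Z + 1) * d)) (p%:Z ^+ 2 - 1) =
    gcdz (j.+1%:Z - i.+1%:Z * p%:Z) (p%:Z ^+ 2 - 1).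
  rewrite -[RHS](gcdz_absorb _ _ (p%:Z + 1) i.+1%:Z); congr (gcdz (gcdz _ _) _).
  by rewrite /d; ring.
rewrite gcdV d_small.
rewrite -NE in nonsplit_iff; rewrite -nE in split_iff double_iff.
apply: iff_trans (in_A11P _ _ _) _; apply: iff_trans (mx2_relations_lucas _ _ _) _.
apply: iff_trans (lucas_sol_Fp p i j pp) _.
have III' : ~~ (2 * 2 ^+ k %| d)%Z ->
  odd_multiple (gcdz d (p%:Z - 1)) (gcdz (j.+1%:Z + i.+1%:Z) (p%:Z - 1)) <->
  odd_multiple d (gcdz (j.+1%:Z + i.+1%:Z) (p%:Z - 1)).
  by move=> Qd; apply: III => //; apply: dvdz_gcdr.
split.
- case=> [/split_iff[/I_II|[Qd od]]|[ps pi /double_iff[a ad]]|].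
  + by case; [left|right; left].
  + by right; right; left; split=> // /(III' Qd).
  + right; right; right; left; split=> //; apply: half_cong_ndvd m2 _ _ _.
    by rewrite -nE; exact: ad.
  + by move=> /nonsplit_iff[/V_iff Vx od]; do 4!right.
case=> [I|[II|[[Qd od]|[[Qd ps pi]|[/V_iff Vx od]]]]].
- by apply/Or31/split_iff; left; apply/I_II; left.
- by apply/Or31/split_iff; left; apply/I_II; right.
- by apply/Or31/split_iff; right; split=> // /(III' Qd).
- apply/Or32; split=> //; apply/double_iff; rewrite nE; exact: half_cong_solvable.
- by apply/Or33/nonsplit_iff.
Qed.
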